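(* Suppose that the following condition is satisfied: $\mathfrak{X}$ has a compatible metric $\mathfrak{d}$ under which there is a decreasing sequence $(\delta_n)_n$ of strictly positive numbers such that $\inf_n\delta_n=0$ and $\mathfrak{m}\{y\in\mathfrak{X}:\mathfrak{d}(x,y)=\delta_n\}=0$ for every $n$ and every $x\in\mathfrak{X}$. Then $\mathcal{M}$ has a right norm-approximate unit, and $\mathcal{M}$ has a left norm-approximate unit. Moreover, each of these approximate units can be chosen to be a sequence.
   Context: $\mathfrak{X}$ is a fixed compact metrizable space and $\mathfrak{m}$ is a fixed Borel probability measure on $\mathfrak{X}$ whose support is all of $\mathfrak{X}$. $\mathcal{M}=\mathcal{M}_{\mathfrak{X},\mathfrak{m}}$ denotes the Banach $*$-algebra $\mathbf{C}(\mathfrak{X}^2)$ of continuous complex functions on $\mathfrak{X}\times\mathfrak{X}$ with the supremum norm, the multiplication $(f\star g)(x,y)=\int_{\mathfrak{X}}f(x,z)g(z,y)\,d\mathfrak{m}(z)$ and the involution $f^*(x,y)=\overline{f(y,x)}$. A compatible metric is one inducing the topology of $\mathfrak{X}$. A right (resp. left) norm-approximate unit for $\mathcal{M}$ is a net $(u_\lambda)_\lambda$ in $\mathcal{M}$ such that $a\star u_\lambda\to a$ (resp. $u_\lambda\star a\to a$) in norm for every $a\in\mathcal{M}$ (no boundedness of the net is required). *)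

(* Defs.v *)
From HB Require Import structures.
From mathcomp Require Import all_boot all_order all_algebra.
From mathcomp Require Import all_classical all_reals all_analysis.
From mathcomp Require Import measurable_realfun complex.

Set Implicit Arguments.
Unset Strict Implicit.
Unset Printing Implicit Defensive.

Import Order.TTheory GRing.Theory Num.Theory.
Import numFieldNormedType.Exports.

Local Open Scope classical_set_scope.
Local Open Scope ring_scope.

(* The topology on R[i] is reached through the alias [^o]. *)
Notation CC R := (R[i])^o.

Notation borel X := (g_sigma_algebraType (@open X)).

Section compatible_metric.
Context {R : realType} {X : topologicalType}.

Definition compatible_metric (d : X -> X -> R) : Prop :=
  [/\ forall x y, 0 <= d x y,
      forall x y, d x y = 0 <-> x = y,
      forall x y, d x y = d y x,
      forall x y z, d x z <= d x y + d y z &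
      forall x, nbhs x =
        filter_from [set e : R | 0 < e] (fun e => [set y | d x y < e])].

End compatible_metric.

Definition metrizable (R : realType) (X : topologicalType) : Prop :=
  exists d : X -> X -> R, compatible_metric d.

Definition msupport (R : realType) (X : ptopologicalType)
    (m : probability (borel X) R) : set X :=
  [set x | forall U : set X, open U -> U x -> (0 < m U)%E].

Definition sphere_condition (R : realType) (X : ptopologicalType)
    (m : probability (borel X) R) : Prop :=
  exists2 d : X -> X -> R, compatible_metric d &
  exists delta : R ^nat,
    [/\ nonincreasing_seq delta,
        forall n, 0 < delta n,
        inf (range delta) = 0 &
        forall n x, m [set y | d x y = delta n] = 0%E].

Section complex_continuity.
Context {R : realType}.

Lemma continuous_Re : continuous (@complex.Re R : CC R -> R).
Proof.
move=> z; apply/(@cvgrPdist_lt _ _ _ _ (nbhs_filter z)) => e e0.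
have e0' : 0 < e%:C%C :> R[i] by rewrite ltcR.
have : \forall w \near z, `|z - w| < e%:C%C.
  exact: (@cvgr_dist_lt _ _ _ (nbhs z) (nbhs_filter z) id z cvg_id _ e0').
apply: filterS => w zw; rewrite -ltcR.
apply: le_lt_trans zw.
by rewrite -raddfB; exact: normc_ge_Re.
Qed.

Lemma continuous_real_complex :
  continuous ((fun x : R => x%:C%C) : R -> CC R).
Proof.
move=> x; apply/cvgrPdist_lt => e e0.
have e0' : 0 < complex.Re e by move: e0; rewrite ltcE => /andP[].
have eE : e = (complex.Re e)%:C%C by rewrite RRe_real// gtr0_real.
have : \forall y \near x, `|x - y| < complex.Re e.
  exact: (@cvgr_dist_lt _ _ _ (nbhs x) _ id x cvg_id _ e0').
apply: filterS => y xy.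
rewrite eE -raddfB /= normc_def /= expr0n addr0 sqrtr_sqr ltcR; exact: xy.
Qed.

Lemma continuous_Im : continuous (@complex.Im R : CC R -> R).
Proof.
have -> : (@complex.Im R : CC R -> R) =
    @complex.Re R \o (fun z : CC R => (- 'i%C : CC R) * z).
  by apply/funext => -[a b] /=; rewrite !(oppr0, mul0r, mulN1r) sub0r opprK.
move=> z; apply: continuous_comp; last exact: continuous_Re.
exact: mulrl_continuous.
Qed.

End complex_continuity.

Section convolution.
Context {R : realType} {X : ptopologicalType} (m : probability (borel X) R).
Hypothesis cX : compact [set: X].

Lemma continuous_borel_measurable (k : X -> R) : continuous k ->
  measurable_fun [set: borel X] k.
Proof.
move=> /continuousP ck.
apply: (measurability _ (RGenOpens.measurableE R)).
move=> _ [_ [a [b ->] <-]]; rewrite setTI; apply: sub_sigma_algebra.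
exact/ck/interval_open.
Qed.

Lemma continuous_borel_integrable (k : X -> R) : continuous k ->
  m.-integrable [set: borel X] (EFin \o k).
Proof.
move=> ck; apply: measurable_bounded_integrable => //.
- by rewrite -ge0_fin_numE// fin_num_measure.
- exact: continuous_borel_measurable.
- have /compact_bounded[M [Mr Mk]] :
      compact (k @` [set: X]).
    by apply: continuous_compact => //; exact: continuous_subspaceT.
  by exists M; split => // r Mr' x _; apply: Mk Mr' _ _; exists x.
Qed.

Lemma continuous_Rintegral_param (T : topologicalType) (k : T * X -> R) :
  continuous k -> continuous (fun t => (\int[m]_(z in [set: borel X]) k (t, z))).
Proof.
move=> ck t0; apply/cvgrPdist_le => e e0.
have ct t : continuous (fun z => k (t, z)).
  move=> z; apply: continuous_comp; last exact: ck.
  by apply: cvg_pair; [exact: cvg_cst|exact: cvg_id].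
have /compact_near_coveringP /(_ _ (nbhs t0)
  (fun t z => `|k (t0, z) - k (t, z)| <= e)) := cX.
have Hnear : forall z, [set: X] z -> \forall z' \near z & t \near nbhs t0,
    `|k (t0, z') - k (t, z')| <= e.
  move=> z _.
  have e20 : 0 < e / 2 by rewrite divr_gt0.
  have /cvgrPdist_lt/(_ _ e20) /= [[A B] /= [At Bz] AB] := ck (t0, z).
  exists (B, A) => //= -[z' t] /= [Bz' At'].
  rewrite (splitr e).
  have := AB (t0, z') (conj (nbhs_singleton At) Bz').
  have := AB (t, z') (conj At' Bz') => /= H1 H2.
  rewrite (le_trans (ler_distD (k (t0, z)) _ _))// lerD// ltW//.
  by rewrite distrC.
move=> /(_ _ Hnear); apply: filterS => t Ht.
have i0 := continuous_borel_integrable (ct t0).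
have i1 := continuous_borel_integrable (ct t).
rewrite -RintegralB//.
apply: le_trans.
  apply: le_normr_Rintegral => //.
  by apply: continuous_borel_integrable => z; apply: cvgB; exact: ct.
have -> : e = \int[m]_(z in [set: borel X]) e.
  by rewrite Rintegral_cst// [X in fine X]probability_setT mulr1.
apply: le_Rintegral => //.
- apply: continuous_borel_integrable => z.
  apply: (@continuous_comp _ _ _ (fun z => k (t0, z) - k (t, z)) Num.norm).
    by apply: cvgB; exact: ct.
  exact: norm_continuous.
- by apply: continuous_borel_integrable => z; exact: cvg_cst.
Qed.

Definition Cintegral (h : X -> R[i]) : R[i] :=
  Complex (\int[m]_(z in [set: borel X]) complex.Re (h z))
          (\int[m]_(z in [set: borel X]) complex.Im (h z)).

Definition conv (f g : X * X -> CC R) : X * X -> CC R :=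
  fun p => Cintegral (fun z => f (p.1, z) * g (z, p.2)).

Lemma continuous_conv (f g : X * X -> CC R) :
  continuous f -> continuous g -> continuous (conv f g).
Proof.
move=> cf cg.
pose k (q : (X * X) * X) : CC R := f (q.1.1, q.2) * g (q.2, q.1.2).
have c11 (q : (X * X) * X) : (fun q : (X * X) * X => q.1.1) @ q --> q.1.1.
  by apply: (@continuous_comp _ _ _ fst fst); exact: cvg_fst.
have c12 (q : (X * X) * X) : (fun q : (X * X) * X => q.1.2) @ q --> q.1.2.
  by apply: (@continuous_comp _ _ _ fst snd); [exact: cvg_fst|exact: cvg_snd].
have c2 (q : (X * X) * X) : (fun q : (X * X) * X => q.2) @ q --> q.2.
  exact: cvg_snd.
have ck : continuous k.
  move=> q; apply: (@cvgM _ _ (nbhs q)).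
    by apply: continuous_comp; [apply: cvg_pair; [exact: c11|exact: c2]|exact: cf].
  by apply: continuous_comp; [apply: cvg_pair; [exact: c2|exact: c12]|exact: cg].
have ckR : continuous (@complex.Re R \o k).
  by move=> q; apply: continuous_comp; [exact: ck|exact: continuous_Re].
have cR := continuous_Rintegral_param ckR.
have ckI : continuous (@complex.Im R \o k).
  by move=> q; apply: continuous_comp; [exact: ck|exact: continuous_Im].
have cI := continuous_Rintegral_param ckI.
have -> : conv f g = fun p =>
    ((\int[m]_(z in [set: borel X]) complex.Re (k (p, z)))%:C%C : CC R) +
    ('i%C : CC R) * (\int[m]_(z in [set: borel X]) complex.Im (k (p, z)))%:C%C.
  by apply/funext => p; rewrite /conv /Cintegral [LHS]complexE.
move=> p; apply: (@cvgD _ _ _ (nbhs p));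
  [|apply: (@cvgM _ _ (nbhs p)); first exact: cvg_cst].
- by apply: continuous_comp; [exact: cR|exact: continuous_real_complex].
- by apply: continuous_comp; [exact: cI|exact: continuous_real_complex].
Qed.

End convolution.

(* C(X^2), the carrier of the algebra. *)
Notation kernels R X := (continuousType (X * X)%type (CC R)).

Section algebra.
Context {R : realType} {X : ptopologicalType} (cX : compact [set: X]).
Context (m : probability (borel X) R).

Definition star (f g : kernels R X) : kernels R X :=
  mkcts (@continuous_conv R X m cX f g cts_fun cts_fun).

(* [complex.Re `|z|] is the modulus of z as an element of R. *)
Definition sup_norm (h : X * X -> CC R) : R :=
  sup (range (fun p => complex.Re `|h p|)).

(* [sup] is 0 by convention on unbounded sets; this does not occur here. *)
Lemma sup_norm_has_sup (f : kernels R X) :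
  has_sup (range (fun p => complex.Re `|f p|)).
Proof.
split; first by exists (complex.Re `|f point|), point.
have cXX : compact [set: X * X].
  by rewrite -setXTT; exact: compact_setX.
pose h p : R := complex.Re `|f p|.
have ch : continuous h.
  move=> p; apply: (@continuous_comp _ (CC R) _ (fun q => `|f q| : CC R)
    (@complex.Re R)); last exact: continuous_Re.
  by apply: (@continuous_comp _ (CC R) (CC R) f (fun z => `|z|));
    [exact: cts_fun|exact: norm_continuous].
have /compact_bounded[M [Mr Mh]] : compact (h @` [set: X * X]).
  by apply: continuous_compact => //; exact: continuous_subspaceT.
exists (M + 1) => _ [p _ <-].
apply: (le_trans (ler_norm _)); apply: (Mh (M + 1)); first by rewrite ltrDl.
by exists p.
Qed.

Definition norm_cvg {L : Type} (F : set_system L) (v : L -> kernels R X)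
    (a : kernels R X) : Prop :=
  sup_norm (fun p => v l p - a p) @[l --> F] --> (0 : R).

Definition right_approximate_unit {L : Type} (F : set_system L)
    (u : L -> kernels R X) : Prop :=
  forall a, norm_cvg F (fun l => star a (u l)) a.

Definition left_approximate_unit {L : Type} (F : set_system L)
    (u : L -> kernels R X) : Prop :=
  forall a, norm_cvg F (fun l => star (u l) a) a.

End algebra.

Definition directed {L : Type} (le : L -> L -> Prop) : Prop :=
  [/\ exists l : L, True,
      forall i, le i i,
      forall i j k, le i j -> le j k -> le i k &
      forall i j, exists2 k, le i k & le j k].

(* The filter along which a net indexed by (L, le) converges. *)
Definition tails {L : Type} (le : L -> L -> Prop) : set_system L :=
  filter_from [set: L] (fun i => [set j | le i j]).

Lemma directed_leq : directed (fun i j : nat => (i <= j)%N).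
Proof.
split; [by exists 0%N|by []|by move=> i j k; exact: leq_trans|].
by move=> i j; exists (maxn i j); rewrite ?leq_maxl ?leq_maxr.
Qed.

Lemma tails_leq : tails (fun i j : nat => (i <= j)%N) = \oo.
Proof. by []. Qed.

(* Main.v *)
Require Import Defs.
From mathcomp Require Import all_boot all_order all_algebra.
From mathcomp Require Import all_classical all_reals all_analysis.
From mathcomp Require Import measurable_realfun complex.
From mathcomp Require Import lra.

Set Implicit Arguments.
Unset Strict Implicit.
Unset Printing Implicit Defensive.

Import Order.TTheory GRing.Theory Num.Theory.
Import numFieldNormedType.Exports.

Local Open Scope classical_set_scope.
Local Open Scope ring_scope.

(* For a compatible metric d, normalize the bumps max(0, 1/(n+1) - d(z, y)) in
   z to integral one; full support makes this possible for every y. This gives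
   continuous nonnegative kernels w_n(z, y) of unit mass in z, supported in
   d(z, y) < 1/(n+1). Uniform continuity then gives
   int a(x, z) w_n(z, y) dm(z) -> a(x, y) uniformly in (x, y), so the w_n are a
   right approximate unit and their transposes a left one. *)

(** * Continuity of a compatible metric and uniform continuity of kernels *)

Section metric.
Context {R : realType} {X : ptopologicalType}.
Variable d : X -> X -> R.
Hypothesis dX : compatible_metric d.

Lemma near_metric_lt (x : X) (e : R) : 0 < e -> \forall y \near x, d x y < e.
Proof.
case: dX => _ _ _ _ nbhsE e0.
by rewrite /prop_near1 nbhsE; exists e.
Qed.

Lemma continuous_metric : continuous (fun p : X * X => d p.1 p.2).
Proof.
case: (dX) => d0 _ dC dT _ [x y]; apply/cvgrPdist_lt => e e0.
have e20 : 0 < e / 2 by lra.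
exists ([set x' | d x x' < e / 2], [set y' | d y y' < e / 2]) => /=.
  by split; exact: near_metric_lt.
move=> [x' y'] /= [xx' yy'].
(* Chained in pairs, these give [|d x y - d x' y'| <= d x x' + d y y']. *)
have := dT x x' y; have := dT x' y' y; have := dT x' x y'; have := dT x y y'.
by rewrite (dC y' y) (dC x' x) ltr_norml => *; apply/andP; split; lra.
Qed.

(** Continuity settles the bound near each point of [X * X] for all large [n]; compactness, in its
    near-covering form along [\oo], makes one threshold serve every point. *)
Lemma unif_continuous_snd (cX : compact [set: X]) (k : X * X -> R) (e : R) :
  continuous k -> 0 < e ->
  \forall n \near \oo, forall x y z,
    d z y < n.+1%:R^-1 -> `|k (x, z) - k (x, y)| <= e.
Proof.
move=> ck e0; case: (dX) => _ _ dC dT nbhsE.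
have cXX : compact [set: X * X] by rewrite -setXTT; exact: compact_setX.
have /compact_near_coveringP /(_ _ \oo (fun n p => forall z,
  d z p.2 < n.+1%:R^-1 -> `|k (p.1, z) - k p| <= e)) cov := cXX.
suff : \forall n \near \oo, [set: X * X] `<=` (fun p => forall z,
    d z p.2 < n.+1%:R^-1 -> `|k (p.1, z) - k p| <= e).
  by apply: filterS => n H x y z; exact: (H (x, y)).
apply: cov => -[x0 y0] _.
have e20 : 0 < e / 2 by lra.
have /cvgrPdist_lt/(_ _ e20) /= [[A B] /= [Ax By] AB] := ck (x0, y0).
move: By; rewrite nbhsE => -[r /= r0 rB].
have r20 : 0 < r / 2 by lra.
(* Half of [r] is spent on the distance from [y0] to [y] and half on that from [y] to [z], so both
   [y] and [z] land in [B]. *)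
exists ([set p | A p.1 /\ d y0 p.2 < r / 2],
        [set n | n.+1%:R^-1 < r / 2]) => /=.
  split; last exact: near_infty_natSinv_lt (PosNum r20).
  exists (A, [set y | d y0 y < r / 2]) => //=; split => //.
  exact: near_metric_lt.
move=> [[x y] n] /= [[Ax' y0y] nr] z /= /lt_trans/(_ nr) zy.
have Bz : B z.
  by apply: rB => /=; have := dT y0 y z; rewrite (dC y z); lra.
have By' : B y by apply: rB => /=; lra.
have := AB (x, z) (conj Ax' Bz); have := AB (x, y) (conj Ax' By').
rewrite /= !ltr_norml ler_norml => /andP[? ?] /andP[? ?].
by apply/andP; split; lra.
Qed.

End metric.

(** * Normalized bumps and their approximation property *)

Section mollifier.
Context {R : realType} {X : ptopologicalType}.
Variable m : probability (borel X) R.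
Hypothesis cX : compact [set: X].

(** Markov's inequality at level [h x / 2]: the superlevel set is an open neighbourhood of [x], so
    full support gives it positive measure. *)
Lemma Rintegral_gt0 (h : X -> R) (x : X) : msupport m = [set: X] ->
  continuous h -> (forall z, 0 <= h z) -> 0 < h x ->
  0 < \int[m]_(z in [set: borel X]) h z.
Proof.
move=> supp ch h0 hx.
have hx2 : 0 < h x / 2 by lra.
have ih := continuous_borel_integrable m cX ch.
have /integrableP[mh _] := ih.
have oU : open [set z | h x / 2 < h z].
  by move/continuousP : ch => /(_ _ (@open_gt _ (h x / 2))).
have mU : (0 < m [set z | h x / 2 < h z]%R)%E.
  by have : msupport m x by [rewrite supp]; apply => //=; lra.
rewrite -lte_fin fineK; last exact: integrable_fin_num.
have := le_integral_abse m measurableT mh hx2.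
under [in X in (_ <= X)%E -> _]eq_integral => z _ do rewrite /= ger0_norm//.
apply: lt_le_trans; apply: mule_gt0; first by rewrite lte_fin.
(* Markov's inequality uses the non-strict superlevel set, which contains the open strict one. *)
apply: (lt_le_trans mU); apply: le_measure; rewrite ?inE.
- exact: sub_sigma_algebra.
- by apply: emeasurable_fun_c_infty => //; exact: measurableT_comp.
- by move=> z /= ?; split => //; rewrite lee_fin ger0_norm// ltW.
Qed.

Variable d : X -> X -> R.
Hypotheses (dX : compatible_metric d) (supp : msupport m = [set: X]).

Definition bump (n : nat) (p : X * X) : R := Num.max 0 (n.+1%:R^-1 - d p.1 p.2).

Definition bump_mass (n : nat) (y : X) : R :=
  \int[m]_(z in [set: borel X]) bump n (z, y).

(** The normalization is in the first argument, the one integrated over when multiplying on the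
    right. *)
Definition mollifier (n : nat) (p : X * X) : R := bump n p / bump_mass n p.2.

Lemma continuous_bump n : continuous (bump n).
Proof.
move=> p; apply: (@continuous_max R (X * X)%type (fun=> 0)
  (fun q => n.+1%:R^-1 - d q.1 q.2)); first exact: cvg_cst.
by apply: cvgB; [exact: cvg_cst|exact: continuous_metric].
Qed.

Lemma bump_ge0 n p : 0 <= bump n p.
Proof. by rewrite /bump le_max lexx. Qed.

Lemma continuous_fst_section (T : topologicalType) (f : X * X -> T) y :
  continuous f -> continuous (fun z => f (z, y)).
Proof.
move=> cf z; apply: continuous_comp; last exact: cf.
by apply: cvg_pair; [exact: cvg_id|exact: cvg_cst].
Qed.

Lemma bump_mass_gt0 n y : 0 < bump_mass n y.
Proof.
apply: (Rintegral_gt0 (x := y)) => //.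
- exact/continuous_fst_section/continuous_bump.
- by move=> z; exact: bump_ge0.
- case: dX => _ d0 _ _ _.
  by rewrite /bump (d0 y y).2// subr0 lt_max invr_gt0 ltr0n orbT.
Qed.

Lemma continuous_mollifier n : continuous (mollifier n).
Proof.
(* [continuous_Rintegral_param] expects the parameter first and the integration variable second. *)
have cswap : continuous (fun q : X * X => bump n (q.2, q.1)).
  move=> q; apply: continuous_comp; last exact: continuous_bump.
  by apply: cvg_pair; [exact: cvg_snd|exact: cvg_fst].
have cmass : continuous (bump_mass n).
  exact: (@continuous_Rintegral_param _ _ m cX _ _ cswap).
move=> p; apply: cvgM; first exact: continuous_bump.
apply: cvgV; first by rewrite gt_eqF// bump_mass_gt0.
by apply: continuous_comp; [exact: cvg_snd|exact: cmass].
Qed.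

Lemma mollifier_ge0 n p : 0 <= mollifier n p.
Proof. by rewrite divr_ge0 ?bump_ge0// ltW// bump_mass_gt0. Qed.

Lemma mollifier_eq0 n z y : n.+1%:R^-1 <= d z y -> mollifier n (z, y) = 0.
Proof. by move=> ny; rewrite /mollifier /bump max_l ?mul0r//= subr_le0. Qed.

Lemma Rintegral_mollifier n y :
  \int[m]_(z in [set: borel X]) mollifier n (z, y) = 1.
Proof.
rewrite /mollifier /= RintegralZr//; last first.
  apply: (continuous_borel_integrable m cX).
  exact/continuous_fst_section/continuous_bump.
by rewrite divff// gt_eqF// bump_mass_gt0.
Qed.

(** By unit mass, both [k (x, y)] and [e] are integrals of constants against the mollifier, so it
    suffices to compare integrands pointwise. *)
Lemma mollifier_approx (k : X * X -> R) (e : R) : continuous k -> 0 < e ->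
  \forall n \near \oo, forall x y,
    `|\int[m]_(z in [set: borel X]) (k (x, z) * mollifier n (z, y))
      - k (x, y)| <= e.
Proof.
move=> ck e0; have := unif_continuous_snd dX cX ck e0.
apply: filterS => n H x y.
have cw := @continuous_fst_section _ _ y (@continuous_mollifier n).
have ckx : continuous (fun z => k (x, z)).
  move=> z; apply: continuous_comp; last exact: ck.
  by apply: cvg_pair; [exact: cvg_cst|exact: cvg_id].
have cprod (f g : X -> R) : continuous f -> continuous g ->
    continuous (fun z => f z * g z).
  by move=> cf cg z; apply: cvgM; [exact: cf|exact: cg].
have cc (c : R) : continuous (fun _ : X => c) by move=> z; exact: cvg_cst.
have icw := continuous_borel_integrable m cX.
have constE c : \int[m]_(z in [set: borel X]) (c * mollifier n (z, y)) = c.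
  by rewrite RintegralZl ?Rintegral_mollifier ?mulr1//; exact: icw.
have cB : continuous (fun z => k (x, z) * mollifier n (z, y)
                               - k (x, y) * mollifier n (z, y)).
  by move=> z; apply: cvgB; apply: cprod.
rewrite -[in X in _ - X](constE (k (x, y))) -RintegralB//; try exact/icw/cprod.
apply: le_trans; first by apply: le_normr_Rintegral => //; exact: icw.
rewrite -[leRHS]constE; apply: le_Rintegral => //.
- apply: icw => z; apply: (@continuous_comp _ _ _
    (fun z => k (x, z) * mollifier n (z, y) - k (x, y) * mollifier n (z, y))
    Num.norm); first exact: cB.
  exact: norm_continuous.
- exact/icw/cprod.
move=> z _; rewrite -mulrBl normrM (ger0_norm (mollifier_ge0 _ _)).
(* Uniform continuity handles the points close to [y]; elsewhere both sides vanish. *)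
have [zy|zy] := ltP (d z y) n.+1%:R^-1.
  by apply: ler_wpM2r; [exact: mollifier_ge0|exact: H].
by rewrite mollifier_eq0// !mulr0.
Qed.

(** * Passage to complex kernels *)

Definition Cmollifier (n : nat) (p : X * X) : CC R := (mollifier n p)%:C%C.

Lemma continuous_Cmollifier n : continuous (Cmollifier n).
Proof.
move=> p; apply: continuous_comp; first exact: continuous_mollifier.
exact: continuous_real_complex.
Qed.

(** The mollifier is real, so the real and imaginary parts of the integral separate, and each is
    approximated to within [e / 2]. *)
Lemma Cmollifier_approx (a : X * X -> CC R) (e : R) : continuous a -> 0 < e ->
  \forall n \near \oo, forall x y,
    complex.Re `|Cintegral m (fun z => a (x, z) * Cmollifier n (z, y))
                 - a (x, y)| <= e.
Proof.
move=> ca e0.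
have e20 : 0 < e / 2 by lra.
have cRe : continuous (fun p => complex.Re (a p)).
  by move=> p; apply: continuous_comp; [exact: ca|exact: continuous_Re].
have cIm : continuous (fun p => complex.Im (a p)).
  by move=> p; apply: continuous_comp; [exact: ca|exact: continuous_Im].
near=> n => x y.
have /(_ x y) HR : forall x y,
    `|\int[m]_(z in [set: borel X]) (complex.Re (a (x, z)) * mollifier n (z, y))
      - complex.Re (a (x, y))| <= e / 2.
  by near: n; exact: (mollifier_approx cRe).
have /(_ x y) HI : forall x y,
    `|\int[m]_(z in [set: borel X]) (complex.Im (a (x, z)) * mollifier n (z, y))
      - complex.Im (a (x, y))| <= e / 2.
  by near: n; exact: (mollifier_approx cIm).
rewrite /Cintegral.
under eq_Rintegral => z _.
  rewrite (_ : complex.Re _ = complex.Re (a (x, z)) * mollifier n (z, y)).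
    over.
  by case: (a (x, z)) => u v /=; rewrite mulr0 subr0.
under [X in Complex _ X]eq_Rintegral => z _.
  rewrite (_ : complex.Im _ = complex.Im (a (x, z)) * mollifier n (z, y)).
    over.
  by case: (a (x, z)) => u v /=; rewrite mulr0 add0r.
move: HR HI; case: (a (x, y)) => u v /=.
set I1 := Rintegral _ _ _; set I2 := Rintegral _ _ _ => HR HI.
rewrite (le_trans (_ : _ <= `|I1 - u| + `|I2 - v|))//; last by lra.
(* The modulus is at most the sum of the absolute values of the two parts: compare squares under the
   root and drop the nonnegative cross term. *)
rewrite -[leRHS]ger0_norm ?addr_ge0// -[leRHS]sqrtr_sqr ler_wsqrtr//.
rewrite [leRHS]sqrrD !real_normK ?num_real// addrAC.
by rewrite lerDl mulrn_wge0// mulr_ge0.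
Unshelve. all: by end_near. Qed.

End mollifier.

(** * Convergence in the supremum norm and the approximate units *)

Lemma norm_cvg_uniform {R : realType} {X : ptopologicalType}
    (v : nat -> kernels R X) (a : kernels R X) :
  (forall e : R, 0 < e -> \forall n \near \oo, forall x y,
    complex.Re `|v n (x, y) - a (x, y)| <= e) ->
  norm_cvg \oo v a.
Proof.
move=> H; apply/cvgrPdist_le => e e0.
apply: filterS (H e e0) => n Hn.
rewrite sub0r normrN ger0_norm.
  apply: ge_sup; first by exists (complex.Re `|v n point - a point|), point.
  by move=> _ [[x y] _ <-]; exact: Hn.
(* The supremum is nonnegative because it dominates the modulus at [point]; [e] witnesses that the
   range is bounded. *)
apply: (@le_trans _ _ (complex.Re `|v n point - a point|)).
  by have := normr_ge0 (v n point - a point); rewrite lecE => /andP[].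
apply: ub_le_sup; last by exists point.
by exists e => _ [[x y] _ <-]; exact: Hn.
Qed.

Theorem theorem3p8 (R : realType) (X : ptopologicalType)
    (cX : compact [set: X]) (metX : metrizable R X)
    (m : probability (borel X) R) (suppm : msupport m = [set: X])
    (Hm : sphere_condition m) :
  [/\ exists (L : Type) (le : L -> L -> Prop) (u : L -> kernels R X),
        directed le /\ right_approximate_unit cX m (tails le) u,
      exists (L : Type) (le : L -> L -> Prop) (u : L -> kernels R X),
        directed le /\ left_approximate_unit cX m (tails le) u,
      exists u : nat -> kernels R X, right_approximate_unit cX m \oo u &
      exists u : nat -> kernels R X, left_approximate_unit cX m \oo u].
Proof.
have [d dX] := metX.
have cswap (f : X * X -> CC R) : continuous f ->
    continuous (fun p : X * X => f (p.2, p.1)).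
  move=> cf p; apply: continuous_comp; last exact: cf.
  by apply: cvg_pair; [exact: cvg_snd|exact: cvg_fst].
have cw n := @continuous_Cmollifier R X m cX d dX suppm n.
pose u n : kernels R X := mkcts (cw n).
pose v n : kernels R X := mkcts (cswap _ (cw n)).
have Hu : right_approximate_unit cX m \oo u.
  move=> a; apply: norm_cvg_uniform => e e0.
  exact: (Cmollifier_approx cX dX suppm (@cts_fun _ _ a) e0).
have Hv : left_approximate_unit cX m \oo v.
  move=> a; apply: norm_cvg_uniform => e e0.
  (* Transposition reverses products: the right-hand estimate for the transpose of [a], read at
     [(y, x)], is the left-hand estimate for [a] at [(x, y)] once the factors under the integral are
     commuted. *)
  have := Cmollifier_approx cX dX suppm (cswap _ (@cts_fun _ _ a)) e0.
  apply: filterS => n H x y; apply: le_trans (H y x) => /=.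
  rewrite /conv /=; under [X in Cintegral m X]eq_fun do rewrite mulrC.
  by [].
split; last 2 first.
- by exists u.
- by exists v.
- exists nat, (fun i j => (i <= j)%N), u; rewrite tails_leq.
  by split => //; exact: directed_leq.
- exists nat, (fun i j => (i <= j)%N), v; rewrite tails_leq.
  by split => //; exact: directed_leq.
Qed.
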